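(* Let $\Gamma\subset SO_0(1,n-1)$ be a convex cocompact Kleinian group. Then the convex cone ${\mathcal T}^+$ is the whole of $H^1(\Gamma,{\mathbb R}^{1,n-1})$.
   Context: Let ${\bf M}^n$ be ${\mathbb R}^n$ with $\langle\cdot|\cdot\rangle=-dx_0^2+dx_1^2+\dots+dx_{n-1}^2$, future being $x_0$ increasing, $N$ the standard Euclidean norm, and ${\mathbb R}^{1,n-1}$ the underlying linear space with its $SO_0(1,n-1)$-action. ${\rm Isom}({\bf M}^n)$ is the group of affine transformations with linear part in $SO_0(1,n-1)$. Let ${\mathcal J}$ be the set of lightlike (degenerate) affine hyperplanes, identified with ${\mathcal S}^+\times{\mathbb R}$, where ${\mathcal S}^+$ is the set of future-oriented lightlike vectors $v$ with $N(v)=1$, via $(v,s)\leftrightarrow\{p:\langle v|p\rangle=s\}$. For $\Lambda\subset{\mathcal J}$ set $\Omega^+(\Lambda)=\{p\in{\bf M}^n:\langle v|p\rangle<s\ \forall(v,s)\in\Lambda\}$. A future complete regular convex domain is a nonempty set $\Omega^+(\Lambda)$ with $\Lambda\subset{\mathcal J}$ closed and containing at least two elements. Let $\Gamma$ be a nonelementary discrete subgroup of $SO_0(1,n-1)$ (nonelementary: all orbits in $\overline{\mathbb H}^{n-1}$ are infinite). A morphism $\rho:\Gamma\to{\rm Isom}({\bf M}^n)$ whose linear part is the identity has the form $\rho(\gamma)x=\gamma x+\tau(\gamma)$ with $\tau\in Z^1(\Gamma,{\mathbb R}^{1,n-1})$, i.e. $\tau(\gamma\gamma')=\tau(\gamma)+\gamma\tau(\gamma')$.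 Coboundaries are $\tau(\gamma)=\gamma v-v$, and they correspond to conjugation by translations, so such representations up to conjugacy by translations are parametrized by $H^1(\Gamma,{\mathbb R}^{1,n-1})=Z^1/B^1$. ${\mathcal T}^+\subset H^1(\Gamma,{\mathbb R}^{1,n-1})$ is the set of classes $[\tau]$ whose associated representation $\rho$ is such that $\rho(\Gamma)$ preserves some future complete regular convex domain. A Kleinian group is a finitely generated nonelementary discrete subgroup $\Gamma$ of $SO_0(1,n-1)$. Let $\widehat\Lambda\subset\partial{\mathbb H}^{n-1}$ be its limit set and $C(\widehat\Lambda)\subset{\mathbb H}^{n-1}$ the convex hull of $\widehat\Lambda$. $\Gamma$ is geometrically finite if for any $\epsilon>0$ the quotient by $\Gamma$ of the $\epsilon$-neighborhood of $C(\widehat\Lambda)$ has finite volume; if moreover this quotient is compact, $\Gamma$ is convex cocompact. *)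

(* Defs.v *)
From HB Require Import structures.
From mathcomp Require Import all_boot all_order all_algebra.
From mathcomp Require Import all_classical all_reals all_analysis.

Set Implicit Arguments.
Unset Strict Implicit.
Unset Printing Implicit Defensive.

Import Order.TTheory GRing.Theory Num.Theory.
Import numFieldNormedType.Exports.

Local Open Scope classical_set_scope.
Local Open Scope ring_scope.

(* M^n and R^{1,n-1} are both 'cV[R]_d.+1 with n = d.+1; the time coordinate
   x_0 is the entry of index 0, so that hyperbolic space has dimension d. *)

Section Minkowski.
Variables (R : realType) (d : nat).
Local Notation V := 'cV[R]_d.+1.
Local Notation M := 'M[R]_d.+1.

Definition mink (x y : V) : R :=
  - (x 0 0 * y 0 0) + \sum_(i < d) x (lift 0 i) 0 * y (lift 0 i) 0.

Definition eucl_norm (x : V) : R := Num.sqrt (\sum_(i < d.+1) x i 0 ^+ 2).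

Definition lorentzO : set M :=
  [set g | forall x y : V, mink (g *m x) (g *m y) = mink x y].

Definition lorentzSO0 : set M := connected_component lorentzO 1%:M.

Definition is_subgroup (G : set M) : Prop :=
  [/\ G 1%:M,
      forall g h, G g -> G h -> G (g *m h) &
      forall g, G g -> G (invmx g)].

Definition discrete_subgroup (G : set M) : Prop :=
  [/\ is_subgroup G, G `<=` lorentzSO0 & isolated G = G].

Definition finitely_generated (G : set M) : Prop :=
  exists S : set M, finite_set S /\ smallest is_subgroup S = G.

(* Hyperbolic space is the hyperboloid model H^d.  Its compactification is the
   space of future causal rays, each ray being represented by its vector of
   Euclidean norm 1; the boundary is then S^+, and H^d embeds by
   x |-> normalize x. *)

Definition hyperbolic : set V := [set x | mink x x = -1 /\ 0 < x 0 0].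

Definition normalize (x : V) : V := (eucl_norm x)^-1 *: x.

Definition Splus : set V :=
  [set v | [/\ mink v v = 0, 0 < v 0 0 & eucl_norm v = 1]].

Definition hyperbolic_bar : set V := normalize @` hyperbolic `|` Splus.

Definition ray_orbit (G : set M) (x : V) : set V :=
  [set normalize (g *m x) | g in G].

Definition nonelementary (G : set M) : Prop :=
  forall x, hyperbolic_bar x -> infinite_set (ray_orbit G x).

Definition limit_set (G : set M) : set V :=
  [set v | Splus v /\ exists2 x, hyperbolic x & closure (ray_orbit G x) v].

(* The points of H^d whose ray lies in the convex hull, taken in the
   projective (Klein) model, of the boundary points in L. *)
Definition hyp_convex_hull (L : set V) : set V :=
  [set x | hyperbolic x /\
    exists (k : nat) (v : 'I_k -> V) (c : 'I_k -> R),
      [/\ forall i, L (v i), forall i, 0 <= c i &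
          x = \sum_(i < k) c i *: v i]].

Definition arcosh (t : R) : R := ln (t + Num.sqrt (t ^+ 2 - 1)).

Definition hyp_dist (x y : V) : R := arcosh (- mink x y).

(* The neighborhood is closed: the quotient of an open one is never compact,
   unless it is the quotient of the whole of H^d. *)
Definition hyp_neighborhood (eps : R) (A : set V) : set V :=
  [set x | hyperbolic x /\
    (ereal_inf [set (hyp_dist x y)%:E | y in A] <= eps%:E)%E].

Definition linear_orbit (G : set M) (x : V) : set V := [set g *m x | g in G].

(* The quotient A / G of a G-invariant subset A, with the quotient of the
   subspace topology.  Taking equality of orbits as the relation makes it an
   equivalence without assuming that G is a group. *)

Section Quotient.
Variables (G : set M) (A : set V).

Definition subspace_of : Type := initial_topology (set_val : A -> V).
HB.instance Definition _ := Topological.on subspace_of.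

Definition orbit_rel (x y : subspace_of) : bool :=
  `[< linear_orbit G (set_val x) = linear_orbit G (set_val y) >].

Lemma orbit_rel_refl : reflexive orbit_rel.
Proof. by move=> x; apply/asboolP. Qed.

Lemma orbit_rel_sym : symmetric orbit_rel.
Proof. by move=> x y; apply/asboolP/asboolP. Qed.

Lemma orbit_rel_trans : transitive orbit_rel.
Proof. by move=> y x z /asboolP xy /asboolP yz; apply/asboolP; rewrite xy. Qed.

Canonical orbit_equiv :=
  EquivRel orbit_rel orbit_rel_refl orbit_rel_sym orbit_rel_trans.

Definition orbit_space : Type := quotient_topology {eq_quot orbit_equiv}%qT.
HB.instance Definition _ := Topological.on orbit_space.

End Quotient.

End Minkowski.

Section Volume.
Variable R : realType.

(* Integral over R^k with respect to Lebesgue measure, as an iterated integral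
   (Tonelli); it is only used on nonnegative Borel functions. *)
Fixpoint iter_integral (k : nat) : ('cV[R]_k -> \bar R) -> \bar R :=
  match k with
  | 0 => fun f => f 0
  | k'.+1 => fun f =>
      (\int[@lebesgue_measure R]_(t in [set: R])
         iter_integral (fun y : 'cV[R]_k' => f (col_mx (t%:M : 'cV[R]_1) y)))%E
  end.

Variable d : nat.

Definition hyp_height (y : 'cV[R]_d) : R :=
  Num.sqrt (1 + \sum_(i < d) y i 0 ^+ 2).

Definition hyp_lift (y : 'cV[R]_d) : 'cV[R]_d.+1 :=
  col_mx ((hyp_height y)%:M : 'cV[R]_1) y.

(* In the coordinates x_1, ..., x_d, the Riemannian volume of the hyperboloid
   is dx_1 ... dx_d / x_0. *)
Definition hyp_volume (B : set 'cV[R]_d.+1) : \bar R :=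
  iter_integral (fun y => (\1_B (hyp_lift y) / hyp_height y)%:E).

(* A discrete subgroup of SO_0(1,d) acts freely on H^d off a null set, so the
   volume of A / G is that of a fundamental domain, i.e. the least volume of a Borel set of H^d whose
   translates cover A. *)
Definition quotient_volume (G : set 'M[R]_d.+1) (A : set 'cV[R]_d.+1) : \bar R :=
  ereal_inf [set hyp_volume B | B in [set B : set 'cV[R]_d.+1 |
    [/\ <<s [set U : set 'cV[R]_d.+1 | open U] >> B,
        B `<=` @hyperbolic R d &
        A `<=` \bigcup_(x in B) linear_orbit G x]]].

End Volume.

Section Kleinian.
Variables (R : realType) (d : nat).
Local Notation V := 'cV[R]_d.+1.
Local Notation M := 'M[R]_d.+1.

Definition kleinian (G : set M) : Prop :=
  [/\ discrete_subgroup G, nonelementary G & finitely_generated G].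

Definition convex_core_neighborhood (G : set M) (eps : R) : set V :=
  hyp_neighborhood eps (hyp_convex_hull (limit_set G)).

Definition geometrically_finite (G : set M) : Prop :=
  forall eps : R, 0 < eps ->
    (quotient_volume G (convex_core_neighborhood G eps) < +oo)%E.

Definition convex_cocompact (G : set M) : Prop :=
  geometrically_finite G /\
  forall eps : R, 0 < eps ->
    compact [set: orbit_space G (convex_core_neighborhood G eps)].

End Kleinian.

Section Domains.
Variables (R : realType) (d : nat).
Local Notation V := 'cV[R]_d.+1.
Local Notation M := 'M[R]_d.+1.

(* The lightlike hyperplane {p | <v|p> = s} is encoded as (v, s). *)
Definition lightlike_hyperplanes : set (V * R) := [set h | Splus h.1].

Definition Omega_plus (L : set (V * R)) : set V :=
  [set p | forall h, L h -> mink h.1 p < h.2].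

(* lightlike_hyperplanes is closed in V * R, so being closed in it or in V * R
   is the same. *)
Definition future_complete_regular_domain (Omega : set V) : Prop :=
  Omega !=set0 /\
  exists L : set (V * R),
    [/\ L `<=` @lightlike_hyperplanes, closed L,
        exists h h', [/\ L h, L h' & h != h'] &
        Omega = Omega_plus L].

(* A cochain is a function on all matrices of which only the restriction to G
   matters; cohomology classes are sets of cocycles, and do not see the values
   outside G. *)

Definition cocycle (G : set M) (tau : M -> V) : Prop :=
  forall g h, G g -> G h -> tau (g *m h) = tau g + g *m tau h.

Definition coboundary (G : set M) (tau : M -> V) : Prop :=
  exists v : V, forall g, G g -> tau g = g *m v - v.

Definition cohomology_class (G : set M) (tau : M -> V) : set (M -> V) :=
  [set tau' | cocycle G tau' /\ coboundary G (fun g => tau' g - tau g)].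

Definition H1 (G : set M) : set (set (M -> V)) :=
  [set cohomology_class G tau | tau in cocycle G].

Definition affine_action (tau : M -> V) (g : M) (x : V) : V := g *m x + tau g.

Definition preserves (G : set M) (tau : M -> V) (Omega : set V) : Prop :=
  forall g, G g -> affine_action tau g @` Omega = Omega.

Definition Tplus (G : set M) : set (set (M -> V)) :=
  [set cohomology_class G tau | tau in [set tau | cocycle G tau /\
    exists2 Omega, future_complete_regular_domain Omega &
                   preserves G tau Omega]].

End Domains.

(* Main.v *)
(* For a cocycle tau it suffices to find a point x and a lightlike direction v
   such that <v | rho(g) x> is bounded above over g in Gamma: the set of all
   lightlike hyperplanes (v, s) with <v | rho(g) x> <= s for every g is closed
   and rho-invariant, and the domain it defines contains x + e_0.

   Take v in the limit set and x = T p with p in the convex hull C, T large.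
   Cocompactness tracks every geodesic ray of C ending at v by elements g_n of
   Gamma such that the g_n^-1 g_(n+1) stay in a finite set.  Hence the increment
   <v | tau(g_(n+1)) - tau(g_n)> is at most a constant times the level
   - <v | x_n> of the ray, which decreases geometrically, and the increments add
   up to a multiple of the initial level - <v | g p>.  Two rays ending at v
   become close at small common level, so comparing the ray from g p with the
   one from p gives <v | tau(g)> <= - T <v | g p> + const.  The term
   <v | g x> = T <v | g p> of <v | rho(g) x> compensates this growth. *)

Require Import Defs.
From mathcomp Require Import all_boot all_order all_algebra.
From mathcomp Require Import all_classical all_reals all_analysis.
From mathcomp Require Import ring lra.

Set Implicit Arguments.
Unset Strict Implicit.
Unset Printing Implicit Defensive.

Import Order.TTheory GRing.Theory Num.Theory.
Import numFieldNormedType.Exports.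

Local Open Scope classical_set_scope.
Local Open Scope ring_scope.

(** * The Lorentzian form and estimates on causal vectors *)

Section MinkowskiAlgebra.
Variables (R : realType) (d : nat).
Local Notation V := 'cV[R]_d.+1.
Implicit Types (x y u v w : V) (a b c : R).

Lemma minkC x y : mink x y = mink y x.
Proof.
rewrite /mink mulrC; congr (_ + _).
by apply: eq_bigr => i _; rewrite mulrC.
Qed.

Lemma minkDl x y u : mink (x + y) u = mink x u + mink y u.
Proof.
rewrite /mink !mxE addrACA -big_split/=; congr (_ + _); first by ring.
by apply: eq_bigr => i _; rewrite !mxE mulrDl.
Qed.

Lemma minkZl a x y : mink (a *: x) y = a * mink x y.
Proof.
rewrite /mink !mxE mulrDr mulr_sumr; congr (_ + _); first by ring.
by apply: eq_bigr => i _; rewrite !mxE mulrA.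
Qed.

Lemma minkDr x y u : mink u (x + y) = mink u x + mink u y.
Proof. by rewrite !(minkC u) minkDl. Qed.

Lemma minkZr a x y : mink x (a *: y) = a * mink x y.
Proof. by rewrite !(minkC x) minkZl. Qed.

Lemma minkNl x y : mink (- x) y = - mink x y.
Proof. by rewrite -scaleN1r minkZl mulN1r. Qed.

Lemma minkBr x y u : mink u (x - y) = mink u x - mink u y.
Proof. by rewrite minkDr -(scaleN1r y) minkZr mulN1r. Qed.

Definition time_vector : V := delta_mx 0 0.

Lemma mink_time x : mink x time_vector = - x 0 0.
Proof.
rewrite /mink /time_vector !mxE eqxx/= mulr1 big1 ?addr0// => i _.
by rewrite !mxE /= mulr0.
Qed.

Lemma hyperbolic_time_vector : hyperbolic time_vector.
Proof. by split; rewrite ?mink_time !mxE eqxx. Qed.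

Definition future_causal : set V := [set w | mink w w <= 0 /\ 0 <= w 0 0].

Lemma hyperbolic_causal x : hyperbolic x -> future_causal x.
Proof. by move=> [xx x0]; split; [rewrite xx; lra|exact: ltW]. Qed.

Lemma Splus_causal v : Splus v -> future_causal v.
Proof. by move=> [vv v0 _]; split; [rewrite vv|exact: ltW]. Qed.

Lemma space_sqr x : \sum_(i < d) x (lift 0 i) 0 ^+ 2 = mink x x + x 0 0 ^+ 2.
Proof.
rewrite /mink addrAC expr2 addNr add0r.
by apply: eq_bigr => i _; rewrite expr2.
Qed.

Lemma hyperbolic_time_ge1 x : hyperbolic x -> 1 <= x 0 0.
Proof.
move=> [xx x0]; have := space_sqr x; rewrite xx => e.
have : 0 <= -1 + x 0 0 ^+ 2 by rewrite -e sumr_ge0// => i _; rewrite sqr_ge0.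
by move=> h; nra.
Qed.

Lemma causal_coord_le w i : future_causal w -> `|w i 0| <= w 0 0.
Proof.
move=> [ww w0]; case: (unliftP 0 i) => [j ->|->]; last by rewrite ger0_norm.
rewrite -ler_sqr ?nnegrE// real_normK ?num_real//.
have := space_sqr w; rewrite (bigD1 j)//= => e.
have : 0 <= \sum_(k < d | k != j) w (lift 0 k) 0 ^+ 2.
  by apply: sumr_ge0 => k _; rewrite sqr_ge0.
lra.
Qed.

Definition l1_norm u : R := \sum_i `|u i 0|.

Lemma norm_mink_le w u : future_causal w -> `|mink w u| <= w 0 0 * l1_norm u.
Proof.
move=> cw; rewrite /mink /l1_norm big_ord_recl mulrDr.
apply: (le_trans (ler_normD _ _)); apply: lerD.
  by rewrite normrN normrM ler_wpM2r// causal_coord_le.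
rewrite mulr_sumr; apply: (le_trans (ler_norm_sum _ _ _)).
by apply: ler_sum => i _; rewrite normrM ler_wpM2r// causal_coord_le.
Qed.

(** A quantitative reversed Cauchy-Schwarz inequality: the squares of w_0 y_i - y_0 w_i have a
    nonnegative sum, and [mink w w <= 0] turns its expansion into this bound. It converts pairings
    into bounds on time coordinates throughout the proof. *)
Lemma causal_time_le w y : future_causal w -> hyperbolic y ->
  w 0 0 <= 2 * y 0 0 * - mink w y.
Proof.
move=> cw hy; have [ww w0] := cw.
have [w00|w_gt0] := eqVneq (w 0 0) 0.
  have := norm_mink_le y cw; rewrite w00 mul0r normr_le0 => /eqP ->.
  by rewrite oppr0 mulr0.
have {}w_gt0 : 0 < w 0 0 by rewrite lt_def w_gt0.
have y1 := hyperbolic_time_ge1 hy; have [yy y0] := hy.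
pose S := \sum_(i < d) w (lift 0 i) 0 * y (lift 0 i) 0.
have mE : mink w y = - (w 0 0 * y 0 0) + S by [].
have : 0 <= \sum_(i < d)
    (w 0 0 * y (lift 0 i) 0 - y 0 0 * w (lift 0 i) 0) ^+ 2.
  by apply: sumr_ge0 => i _; rewrite sqr_ge0.
have -> : \sum_(i < d)
    (w 0 0 * y (lift 0 i) 0 - y 0 0 * w (lift 0 i) 0) ^+ 2 =
  w 0 0 ^+ 2 * (mink y y + y 0 0 ^+ 2) - 2 * w 0 0 * y 0 0 * S
  + y 0 0 ^+ 2 * (mink w w + w 0 0 ^+ 2).
  rewrite -!space_sqr !mulr_sumr -sumrB -big_split/=.
  by apply: eq_bigr => i _; ring.
rewrite yy => h.
have h1 : y 0 0 ^+ 2 * mink w w <= 0 by rewrite mulr_ge0_le0 ?sqr_ge0.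
have : 0 <= w 0 0 * (w 0 0 * (2 * y 0 0 ^+ 2 - 1) - 2 * y 0 0 * S) by nra.
rewrite pmulr_rge0// mE; nra.
Qed.

Lemma mink_causal_lt0 w y : future_causal w -> 0 < w 0 0 -> hyperbolic y ->
  mink w y < 0.
Proof.
move=> cw w0 hy; have := causal_time_le cw hy; have := hyperbolic_time_ge1 hy.
by move=> h1 h2; rewrite ltNge; apply/negP => h3; nra.
Qed.

(** Otherwise [- w] would be future causal, and [causal_time_le] would make its time coordinate
    negative. *)
Lemma causal_time_gt0 w y : mink w w <= 0 -> hyperbolic y -> mink w y < 0 ->
  0 < w 0 0.
Proof.
move=> ww hy wy; rewrite ltNge; apply/negP => w0.
have cw : future_causal (- w).
  by split; [rewrite minkNl minkC minkNl opprK|rewrite mxE oppr_ge0].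
have := causal_time_le cw hy; rewrite minkNl mxE opprK.
have := hyperbolic_time_ge1 hy; nra.
Qed.

(** Null vectors of Euclidean norm 1 share the same positive time coordinate, so [v - w] is a
    nonzero spatial vector; its positive square is [- 2 * mink v w]. *)
Lemma mink_Splus_lt0 v w : Splus v -> Splus w -> v != w -> mink v w < 0.
Proof.
move=> [vv v0 nv] [ww w0 nw] vw.
have tsq x : mink x x = 0 -> eucl_norm x = 1 -> 2 * x 0 0 ^+ 2 = 1.
  move=> xx nx; have : eucl_norm x ^+ 2 = 1 by rewrite nx expr1n.
  rewrite /eucl_norm sqr_sqrtr; last by apply: sumr_ge0 => i _; rewrite sqr_ge0.
  by rewrite big_ord_recl space_sqr xx; lra.
have e0 : v 0 0 = w 0 0.
  apply/eqP; rewrite -(@eqrXn2 _ 2%N) ?ltW//; apply/eqP.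
  by have := tsq _ vv nv; have := tsq _ ww nw; lra.
have e : mink (v - w) (v - w) = - 2 * mink v w.
  by rewrite !minkBr ![mink (v - w) _]minkC !minkBr vv ww (minkC w v); ring.
have : 0 < mink (v - w) (v - w).
  have := space_sqr (v - w); rewrite !mxE e0 subrr expr0n addr0 => <-.
  rewrite lt_def sumr_ge0 ?andbT; last by move=> i _; rewrite sqr_ge0.
  apply/negP => /eqP /psumr_eq0P h; move/negP: vw; apply.
  apply/eqP/matrixP => i j; rewrite (ord1 j).
  case: (unliftP 0 i) => [k ->|->]; last exact: e0.
  have /eqP := h (fun i _ => sqr_ge0 _) k isT.
  by rewrite sqrf_eq0 !mxE subr_eq0 => /eqP.
by rewrite e; lra.
Qed.

Lemma eucl_norm_sqr x : eucl_norm x ^+ 2 = \sum_(i < d.+1) x i 0 ^+ 2.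
Proof. by rewrite sqr_sqrtr//; apply: sumr_ge0 => i _; rewrite sqr_ge0. Qed.

Lemma coord_le_eucl_norm x i : `|x i 0| <= eucl_norm x.
Proof.
rewrite -ler_sqr ?nnegrE ?sqrtr_ge0// real_normK ?num_real// eucl_norm_sqr.
by rewrite (bigD1 i)//= lerDl sumr_ge0// => j _; rewrite sqr_ge0.
Qed.

Lemma eucl_normZ a x : 0 <= a -> eucl_norm (a *: x) = a * eucl_norm x.
Proof.
move=> a0; rewrite /eucl_norm.
under eq_bigr do rewrite mxE exprMn.
by rewrite -mulr_sumr sqrtrM ?sqr_ge0// sqrtr_sqr ger0_norm.
Qed.

Lemma normalizeZ a x : 0 < a -> normalize (a *: x) = normalize x.
Proof.
move=> a0; rewrite /normalize eucl_normZ ?ltW// scalerA invfM mulrAC mulVf ?mul1r//.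
by rewrite gt_eqF.
Qed.

Lemma eucl_norm_gt0 x : 0 < x 0 0 -> 0 < eucl_norm x.
Proof. by move=> x0; apply: lt_le_trans (coord_le_eucl_norm x 0); rewrite gtr0_norm. Qed.

Lemma eucl_norm_normalize x : 0 < x 0 0 -> eucl_norm (normalize x) = 1.
Proof.
move=> x0; have n0 := eucl_norm_gt0 x0.
by rewrite eucl_normZ ?invr_ge0 ?ltW// mulVf// gt_eqF.
Qed.

Lemma normalizeE x : 0 < x 0 0 -> x = eucl_norm x *: normalize x.
Proof.
move=> x0; rewrite /normalize scalerA divff ?scale1r//.
by rewrite gt_eqF ?eucl_norm_gt0.
Qed.

Lemma normalize_Splus x : mink x x = 0 -> 0 < x 0 0 -> Splus (normalize x).
Proof.
move=> xx x0; split; last exact: eucl_norm_normalize.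
  by rewrite /normalize minkZl minkZr xx !mulr0.
by rewrite mxE mulr_gt0// invr_gt0 eucl_norm_gt0.
Qed.

End MinkowskiAlgebra.

(** * Lorentz matrices preserving the future, and finiteness from discreteness *)

Section LorentzGroup.
Variables (R : realType) (d : nat).
Local Notation V := 'cV[R]_d.+1.
Local Notation M := 'M[R]_d.+1.
Implicit Types (g h : M) (x y w : V).

(** The orthochronous group: [g 0 0] is the time coordinate of the image of [time_vector]. *)
Definition future_lorentz : set M := [set g | lorentzO g /\ 0 < g 0 0].

Lemma mulmx_time_vector g i : (g *m time_vector R d) i 0 = g i 0.
Proof. by rewrite /time_vector -colE mxE. Qed.

Lemma lorentzO_time_sqr_ge1 g : lorentzO g -> 1 <= g 0 0 ^+ 2.
Proof.
move=> lg; have := space_sqr (g *m time_vector R d).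
rewrite lg (hyperbolic_time_vector R d).1 mulmx_time_vector => e.
have : 0 <= -1 + g 0 0 ^+ 2 by rewrite -e sumr_ge0// => i _; rewrite sqr_ge0.
lra.
Qed.

(** On [lorentzO] the entry [g 0 0] has square at least 1, so it cannot change sign on a connected
    set containing the identity. *)
Lemma lorentzSO0_future : @lorentzSO0 R d `<=` future_lorentz.
Proof.
move=> g [C [C1 CO cC] Cg]; split; first exact: CO.
have /connected_intervalP iC : connected ((fun A : M => A 0 0) @` C).
  apply: connected_continuous_connected => //; apply: continuous_subspaceT.
  exact: coord_continuous.
rewrite ltNge; apply/negP => g0.
have [h Ch h0] : ((fun A : M => A 0 0) @` C) 0.
  apply: (iC (g 0 0) 1); [by exists g| |by rewrite g0 ler01].
  by exists 1%:M => //; rewrite mxE eqxx.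
by have := lorentzO_time_sqr_ge1 (CO _ Ch); rewrite h0 expr0n/= ler10.
Qed.

Lemma future_lorentz_time_gt0 g w : future_lorentz g ->
  mink w w <= 0 -> 0 < w 0 0 -> 0 < (g *m w) 0 0.
Proof.
move=> [lg g0] ww w0.
have hg : hyperbolic (g *m time_vector R d).
  by split; rewrite ?lg ?mulmx_time_vector// (hyperbolic_time_vector R d).1.
apply: (causal_time_gt0 _ hg); first by rewrite lg.
by rewrite lg mink_time oppr_lt0.
Qed.

Lemma future_lorentz_hyperbolic g x : future_lorentz g ->
  hyperbolic x -> hyperbolic (g *m x).
Proof.
move=> fg [xx x0]; split; first by rewrite fg.1.
by apply: future_lorentz_time_gt0; rewrite ?xx ?lerN10.
Qed.

Lemma future_lorentz_causal g w : future_lorentz g ->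
  future_causal w -> 0 < w 0 0 -> future_causal (g *m w).
Proof.
move=> fg [ww w0] w1; split; first by rewrite fg.1.
exact/ltW/future_lorentz_time_gt0.
Qed.

(** A kernel vector is orthogonal to everything; so it is null with zero time coordinate, hence
    zero. *)
Lemma lorentzO_unitmx g : lorentzO g -> g \in unitmx.
Proof.
move=> lg; rewrite -unitmx_tr -row_free_unit; apply: inj_row_free => v vg.
have gv : g *m v^T = 0 by apply: trmx_inj; rewrite trmx_mul trmxK vg trmx0.
have vy y : mink v^T y = 0 by rewrite -lg gv -(scale0r 0) minkZl mul0r.
have v0 : v^T 0 0 = 0.
  by apply/eqP; rewrite -oppr_eq0 -mink_time vy.
have cv : future_causal v^T by split; rewrite ?vy ?v0.
apply: trmx_inj; apply/matrixP => i j; rewrite (ord1 j) trmx0 [RHS]mxE.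
by apply/eqP; rewrite -normr_le0 -v0 causal_coord_le.
Qed.

(** Column 0 is future causal. For another column, e_0 + e_k is null and pairs to -1 with e_0, so
    its image has time coordinate at most [2 * g 0 0]; subtracting column 0 costs one more
    [g 0 0]. *)
Lemma future_lorentz_coord_le g i j : future_lorentz g ->
  `|g i j| <= 3 * g 0 0.
Proof.
move=> fg; have he := hyperbolic_time_vector R d.
have hge := future_lorentz_hyperbolic fg he.
have ge1 := hyperbolic_time_ge1 hge; rewrite mulmx_time_vector in ge1.
have ci : `|g i 0| <= g 0 0.
  by have := causal_coord_le i (hyperbolic_causal hge); rewrite !mulmx_time_vector.
case: (unliftP 0 j) => [k ->|->]; last by apply: (le_trans ci); lra.
pose e : V := delta_mx (lift 0 k) 0.
have et : (time_vector R d + e) 0 0 = 1 by rewrite !mxE /= addr0.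
have ee : mink e e = 1.
  rewrite /mink !mxE /= mulr0 oppr0 add0r (bigD1 k)//= !mxE eqxx mulr1 big1 ?addr0//.
  by move=> l lk; rewrite !mxE (inj_eq lift_inj) (negbTE lk) mulr0.
have le : mink (time_vector R d + e) (time_vector R d + e) = 0.
  rewrite minkDr mink_time et minkDl ee minkC mink_time !mxE /= oppr0 add0r.
  by rewrite addNr.
have le0 : mink (time_vector R d + e) (time_vector R d + e) <= 0 by rewrite le.
have cg : future_causal (g *m (time_vector R d + e)).
  by apply: future_lorentz_causal => //; [split; rewrite ?le0 ?et|rewrite et].
have := causal_time_le cg hge; rewrite fg.1 mink_time et opprK mulr1.
rewrite [in X in _ <= X]mulmx_time_vector => b.
have := causal_coord_le i cg.
have -> : (g *m (time_vector R d + e)) i 0 = g i 0 + g i (lift 0 k).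
  by rewrite mulmxDr mxE mulmx_time_vector /e -colE [in LHS]mxE.
move=> c; rewrite -[X in `|X|](addKr (g i 0)).
apply: (le_trans (ler_normD _ _)); rewrite normrN; lra.
Qed.

Section DiscreteSubgroup.
Variable G : set M.
Hypothesis discreteG : discrete_subgroup G.

Lemma discrete_future g : G g -> future_lorentz g.
Proof. by have [_ sG _] := discreteG; move=> /sG /lorentzSO0_future. Qed.

Lemma discrete_unitmx g : G g -> g \in unitmx.
Proof. by move=> /discrete_future [/lorentzO_unitmx]. Qed.

Lemma group_one : G 1%:M.
Proof. by have [[]] := discreteG. Qed.

Lemma group_mul g h : G g -> G h -> G (g *m h).
Proof. by have [[_ mulG _] _ _] := discreteG; exact: mulG. Qed.

Lemma group_inv g : G g -> G (invmx g).
Proof. by have [[_ _ invG] _ _] := discreteG; exact: invG. Qed.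

Lemma mink_invmx g x y : G g -> mink (invmx g *m x) y = mink x (g *m y).
Proof.
move=> Gg; rewrite -(discrete_future Gg).1 mulmxA mulmxV ?mul1mx//.
exact: discrete_unitmx.
Qed.

(** These matrices have bounded entries. Two of them in the same cell of a fine grid have a quotient
    close to 1, hence equal to 1 since the identity is isolated; so rounding embeds the set in a
    finite type. *)
Lemma finite_time_le (B : R) : finite_set [set g | G g /\ g 0 0 <= B].
Proof.
have [_ _ iG] := discreteG.
have [_ [U U1 UG]] : isolated G 1%:M by rewrite iG; exact: group_one.
move/nbhs_ballP : U1 => [e /= e0 eU].
pose K := 3 * `|B| + 1.
have K0 : 0 < K by rewrite /K; have := normr_ge0 B; lra.
(* With this mesh the entries of [invmx g *m h - 1] are at most (d+1) K D = e / 2. *)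
pose D := e / (2 * K * d.+1%:R).
have dn0 : 0 < d.+1%:R :> R by rewrite ltr0n.
have D0 : 0 < D by rewrite divr_gt0// !mulr_gt0.
have bnd g i j : G g -> g 0 0 <= B -> `|g i j| <= K.
  move=> Gg gB; apply: (le_trans (future_lorentz_coord_le i j (discrete_future Gg))).
  by have := ler_norm B; rewrite /K; lra.
pose N := Num.bound (K / D).
have KN : K / D < N%:R.
  by rewrite archi_boundP// divr_ge0 ?ltW.
pose A := [set g | G g /\ g 0 0 <= B].
(* The shift by [N] makes the rounded entries nonnegative. *)
pose f g : 'M['I_(N + N).+1]_d.+1 := \matrix_(i, j) inord (Num.truncn (g i j / D + N%:R)).
have fE g i j : A g -> (f g i j : nat) = Num.truncn (g i j / D + N%:R) /\
    0 <= g i j / D + N%:R.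
  move=> [Gg gB]; have := bnd g i j Gg gB => gK.
  have : `|g i j / D| <= N%:R.
    rewrite normrM (gtr0_norm (_ : 0 < D^-1)) ?invr_gt0//.
    by apply/ltW/(le_lt_trans _ KN); rewrite ler_wpM2r// invr_ge0 ltW.
  rewrite ler_norml => /andP[l1 l2]; have p : 0 <= g i j / D + N%:R by lra.
  split=> //; rewrite mxE inordK// ltnS -(ler_nat R).
  have /andP[/le_trans t _] := truncn_itv p; apply: t.
  by rewrite natrD lerD2r.
have inj : {in A &, injective f}.
  move=> g h; rewrite !inE => Ag Ah fgh.
  have [Gg gB] := Ag; have [Gh hB] := Ah.
  have gh i j : `|h i j - g i j| <= D.
    have [e1 p1] := fE g i j Ag; have [e2 p2] := fE h i j Ah.
    have /andP[] := truncn_itv p1; have /andP[] := truncn_itv p2.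
    rewrite -e1 -e2 fgh -natr1 => a1 a2 a3 a4.
    have -> : h i j - g i j = D * (h i j / D - g i j / D).
      by rewrite -mulrBl mulrCA divff ?mulr1// gt_eqF.
    rewrite normrM gtr0_norm//; apply: ler_piMr; first exact: ltW.
    by apply/ltW; rewrite ltr_norml; lra.
  have Gi := group_inv Gg.
  (* Inversion keeps this entry, so the bound [K] also holds for the entries of the inverse. *)
  have ig00 : (invmx g) 0 0 = g 0 0.
    have := mink_invmx (time_vector R d) (time_vector R d) Gg.
    rewrite mink_time minkC mink_time !mulmx_time_vector.
    by move/eqP; rewrite eqr_opp => /eqP.
  have : (U `&` G) (invmx g *m h).
    split; last exact: group_mul.
    apply: eU; split=> // i j; rewrite /ball/=.
    have -> : 1%:M i j - (invmx g *m h) i j = - (invmx g *m (h - g)) i j.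
      by rewrite mulmxBr mulVmx ?discrete_unitmx// !mxE opprB.
    rewrite normrN mxE; apply: (le_lt_trans (ler_norm_sum _ _ _)).
    apply: (@le_lt_trans _ _ (\sum_(k < d.+1) K * D)).
      apply: ler_sum => k _; rewrite normrM ler_pM//.
        by apply: bnd => //; rewrite ig00.
      by rewrite !mxE; exact: gh.
    rewrite sumr_const card_ord -mulr_natr /D.
    have -> : K * (e / (2 * K * d.+1%:R)) * d.+1%:R = e / 2.
      by field; rewrite !gt_eqF.
    by rewrite ltr_pdivrMr// ltr_pMr// ltr1n.
  rewrite UG /= => e1.
  by rewrite -[LHS]mulmx1 -e1 mulmxA mulmxV ?mul1mx// discrete_unitmx.
by rewrite -(eq_finite_set (inj_card_eq inj)); exact: finite_finset.
Qed.

End DiscreteSubgroup.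

End LorentzGroup.

(** * Entrywise limits and continuity of the operations on vectors *)

Section MatrixLimits.
Variable R : realType.

Lemma cvg_mx T (F : set_system T) {FF : Filter F} m n
    (f : T -> 'M[R]_(m, n)) (A : 'M[R]_(m, n)) :
  (forall i j, f x i j @[x --> F] --> A i j) -> f x @[x --> F] --> A.
Proof.
move=> fA U [P nP PU].
have FP : F [set x | forall ij : 'I_m * 'I_n, P ij.1 ij.2 (f x ij.1 ij.2)].
  by apply: filter_forall => -[i j]; exact: fA.
apply: (@filterS _ F FF _ [set x | U (f x)] _ FP) => x Px.
by apply: PU => i j; exact: (Px (i, j)).
Qed.

Lemma cvg_coord T (F : set_system T) {FF : Filter F} m n
    (f : T -> 'M[R]_(m, n)) (A : 'M[R]_(m, n)) i j :
  f x @[x --> F] --> A -> f x i j @[x --> F] --> A i j.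
Proof. exact: (continuous_cvg _ (@coord_continuous R m n i j A)). Qed.

Lemma cvg_sumr T (F : set_system T) {FF : Filter F} (I : finType)
    (f : I -> T -> R) (a : I -> R) :
  (forall i, f i x @[x --> F] --> a i) ->
  \sum_i f i x @[x --> F] --> \sum_i a i.
Proof.
move=> fa; refine (@cvg_big R I +%R 0 xpredT (@add_continuous R) T F _ f a FF _).
by move=> i _; exact: fa.
Qed.

Lemma cvg_mulmx T (F : set_system T) {FF : Filter F} m n p (g : 'M[R]_(m, n))
    (f : T -> 'M[R]_(n, p)) (A : 'M[R]_(n, p)) :
  f x @[x --> F] --> A -> g *m f x @[x --> F] --> g *m A.
Proof.
move=> fA; apply: cvg_mx => i j; rewrite mxE.
under eq_cvg do rewrite mxE.
by apply: cvg_sumr => k; apply: cvgM; [exact: cvg_cst|exact: cvg_coord].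
Qed.

Lemma cvg_mink T (F : set_system T) {FF : Filter F} d
    (f g : T -> 'cV[R]_d.+1) (x y : 'cV[R]_d.+1) :
  f t @[t --> F] --> x -> g t @[t --> F] --> y ->
  mink (f t) (g t) @[t --> F] --> mink x y.
Proof.
move=> fx gy; apply: cvgD.
  by apply: cvgN; apply: cvgM; exact: cvg_coord.
by apply: cvg_sumr => k; apply: cvgM; exact: cvg_coord.
Qed.

Lemma cvg_eucl_norm T (F : set_system T) {FF : Filter F} d
    (f : T -> 'cV[R]_d.+1) (x : 'cV[R]_d.+1) :
  f t @[t --> F] --> x -> eucl_norm (f t) @[t --> F] --> eucl_norm x.
Proof.
move=> fx.
have sqr : \sum_i f t i 0 ^+ 2 @[t --> F] --> \sum_i x i 0 ^+ 2.
  apply: cvg_sumr => k; rewrite expr2; under eq_cvg do rewrite expr2.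
  by apply: cvgM; exact: cvg_coord.
exact: (continuous_cvg _ (@sqrt_continuous R _) sqr).
Qed.

Lemma cvg_normalize T (F : set_system T) {FF : Filter F} d
    (f : T -> 'cV[R]_d.+1) (x : 'cV[R]_d.+1) :
  0 < x 0 0 -> f t @[t --> F] --> x ->
  normalize (f t) @[t --> F] --> normalize x.
Proof.
move=> x0 fx; apply: cvgZ => //; apply: cvgV; last exact: cvg_eucl_norm.
by rewrite gt_eqF// eucl_norm_gt0.
Qed.

(** The cube of row vectors is compact; a cluster point of the transposed sequence at infinity
    adheres to every tail. *)
Lemma bounded_seq_cluster d (u : nat -> 'cV[R]_d) :
  (forall k i, `|u k i 0| <= 1) ->
  exists w, forall K, closure (u @` [set k | (K <= k)%N]) w.
Proof.
move=> u1.
have Acpt := @rV_compact R d (fun=> [set` `[-1, 1]]) (fun=> @segment_compact R (-1) 1).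
have [|r [_ cr]] := Acpt ((fun k => (u k)^T) @ \oo) _.
  by exists 0%N => // k _ i /=; rewrite in_itv/= -ler_norml mxE.
exists r^T => K B nB.
have [| |s []] := cr ((fun k => (u k)^T) @` [set k | (K <= k)%N]) (trmx @^-1` B).
- by exists K => // k Kk /=; exists k.
- suff : trmx x @[x --> r] --> r^T by apply.
  apply: (@cvg_mx _ (nbhs r)) => i j; rewrite mxE.
  by under eq_cvg do rewrite mxE; exact: coord_continuous.
- move=> [k Kk <-]; rewrite /preimage/= trmxK => Bu.
  by exists (u k); split => //; exists k.
Qed.

Lemma closure_closed_sub (T : topologicalType) (A C : set T) :
  closed C -> A `<=` C -> closure A `<=` C.
Proof. by move=> /closure_id {2}-> AC; exact: closureS. Qed.

End MatrixLimits.

(** * Convex cones *)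

Section ConeHull.
Variables (R : realType) (d : nat).
Local Notation V := 'cV[R]_d.+1.
Implicit Types (L : set V) (x v : V).

(** The linear part of [hyp_convex_hull], separated from the hyperboloid condition so that
    combinations can be built step by step. *)
Definition cone_hull L : set V := [set x | exists (k : nat) (v : 'I_k -> V) (c : 'I_k -> R),
  [/\ forall i, L (v i), forall i, 0 <= c i & x = \sum_(i < k) c i *: v i]].

Lemma cone_hull0 L : cone_hull L 0.
Proof.
exists 0%N, (fun=> 0), (fun=> 0); split=> //; first by case.
by rewrite big_ord0.
Qed.

Lemma cone_hull_add L v x (a b : R) : L v -> cone_hull L x -> 0 <= a -> 0 <= b ->
  cone_hull L (b *: x + a *: v).
Proof.
move=> Lv [k [w [c [Lw c0 ->]]]] a0 b0.
exists k.+1, (fun i => oapp w v (unlift 0 i)),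
  (fun i => oapp (fun j => b * c j) a (unlift 0 i)); split.
- by move=> i; case: (unlift 0 i) => [j|] /=.
- by move=> i; case: (unlift 0 i) => [j|] //=; rewrite mulr_ge0.
- rewrite big_ord_recl unlift_none /= addrC scaler_sumr; congr (_ + _).
  by apply: eq_bigr => i _; rewrite liftK /= scalerA.
Qed.

End ConeHull.

(** * Invariance and nonemptiness of the limit set and of its hull *)

Section LimitSet.
Variables (R : realType) (d : nat).
Local Notation V := 'cV[R]_d.+1.
Local Notation M := 'M[R]_d.+1.
Implicit Types (g h : M) (x v : V).
Variable G : set M.
Hypothesis discreteG : discrete_subgroup G.

Lemma Splus_mulmx g v : G g -> Splus v -> Splus (normalize (g *m v)).
Proof.
move=> /(discrete_future discreteG) fg [vv v0 _]; apply: normalize_Splus.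
  by rewrite fg.1.
by apply: future_lorentz_time_gt0; rewrite ?vv.
Qed.

Lemma limit_set_mulmx g v : G g -> limit_set G v ->
  limit_set G (normalize (g *m v)).
Proof.
move=> Gg [Sv [x hx cv]]; have fg := discrete_future discreteG Gg.
split; first exact: Splus_mulmx.
have [vv v0 _] := Sv.
have gv0 : 0 < (g *m v) 0 0 by apply: future_lorentz_time_gt0; rewrite ?vv.
exists x => // B nB.
have cf : normalize (g *m y) @[y --> v] --> normalize (g *m v).
  apply: (@cvg_normalize R V (nbhs v) _ d (mulmx g)) => //.
  by apply: (@cvg_mulmx R V (nbhs v) _ _ _ _ g id); exact: cvg_id.
have [_ [[h Gh <-] Bh]] := cv _ (cf _ nB).
exists (normalize (g *m h *m x)); split.
  by exists (g *m h) => //; exact: group_mul.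
move: Bh; rewrite /= {2}/normalize -scalemxAr normalizeZ ?mulmxA//.
rewrite invr_gt0 eucl_norm_gt0//.
by case: (future_lorentz_hyperbolic (discrete_future discreteG Gh) hx).
Qed.

Lemma cone_hull_mulmx g x : G g -> cone_hull (limit_set G) x ->
  cone_hull (limit_set G) (g *m x).
Proof.
move=> Gg [k [v [c [Lv c0 ->]]]].
(* The coefficients absorb the factors lost by renormalizing. *)
exists k, (fun i => normalize (g *m v i)), (fun i => c i * eucl_norm (g *m v i)).
split=> [i|i|]; first exact: limit_set_mulmx.
  by rewrite mulr_ge0// sqrtr_ge0.
rewrite mulmx_sumr; apply: eq_bigr => i _; rewrite -scalemxAr -scalerA -normalizeE//.
have [[vv v0 _] _] := Lv i.
by apply: future_lorentz_time_gt0; rewrite ?vv//; exact: (discrete_future discreteG).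
Qed.

Hypothesis nonelementaryG : nonelementary G.

(** Otherwise [finite_time_le] would make the group, hence the orbit of [time_vector], finite. *)
Lemma time_unbounded (B : R) : exists2 g, G g & B < g 0 0.
Proof.
apply: contrapT => nG.
have : finite_set (ray_orbit G (normalize (time_vector R d))).
  apply: finite_image; apply: sub_finite_set (finite_time_le discreteG B).
  move=> g Gg; split=> //; rewrite leNgt; apply/negP => Bg; apply: nG.
  by exists g.
apply: nonelementaryG; left; exists (time_vector R d) => //.
exact: hyperbolic_time_vector.
Qed.

(** A cluster point of the normalized orbit points [u k] works: [u k] has Lorentz square -1 / |g_k
    e_0|^2, which tends to 0, so the limit is null. *)
Lemma limit_set_nonempty : exists v, limit_set G v.
Proof.
have /choice[g gP] : forall k : nat, exists g, G g /\ k.+1%:R < g 0 0.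
  by move=> k; have [g Gg kg] := time_unbounded k.+1%:R; exists g.
pose e := time_vector R d.
have he k : hyperbolic (g k *m e).
  apply: future_lorentz_hyperbolic; last exact: hyperbolic_time_vector.
  by have [/(discrete_future discreteG)] := gP k.
pose u k := normalize (g k *m e).
have nu k : eucl_norm (u k) = 1 by apply: eucl_norm_normalize; case: (he k).
have [|w cw] := @bounded_seq_cluster R _ u.
  by move=> k i; apply: (le_trans (coord_le_eucl_norm _ _)); rewrite nu.
have wC (C : set V) K : closed C -> (forall k, (K <= k)%N -> C (u k)) -> C w.
  move=> cC uC; apply: (closure_closed_sub cC _ (cw K)).
  by move=> _ [k Kk <-]; exact: uC.
have nw : eucl_norm w = 1.
  apply: (wC [set x | eucl_norm x = 1] 0%N) => [|k _]; last exact: nu.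
  apply: (@preimage_closed _ _ _ [set r : R | r = 1]); last exact: closed_eq.
  by move=> x _; apply: (@cvg_eucl_norm R V (nbhs x) _ d id); exact: cvg_id.
have w0 : 0 <= w 0 0.
  apply: (wC [set x : V | 0 <= x 0 0] 0%N).
    apply: (@preimage_closed _ _ _ [set r : R | 0 <= r]); last exact: closed_ge.
    by move=> x _; exact: coord_continuous.
  move=> k _ /=; rewrite mxE mulr_ge0 ?invr_ge0 ?sqrtr_ge0//.
  by have [_ /ltW] := he k.
have um k : mink (u k) (u k) = - (eucl_norm (g k *m e)) ^- 2.
  by rewrite /u /normalize minkZl minkZr (he k).1 expr2 invfM; ring.
have ww0 : mink w w <= 0.
  apply: (wC [set x : V | mink x x <= 0] 0%N).
    apply: (@preimage_closed _ _ _ [set r : R | r <= 0]); last exact: closed_le.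
    by move=> x _; apply: (@cvg_mink R V (nbhs x) _ d id id); exact: cvg_id.
  by move=> k _ /=; rewrite um oppr_le0 invr_ge0 sqr_ge0.
have ww1 : 0 <= mink w w.
  rewrite leNgt; apply/negP => ww.
  pose q := - mink w w; have q0 : 0 < q by rewrite oppr_gt0.
  pose N := Num.bound q^-1.
  have qN : 1 < N%:R * q.
    by rewrite -ltr_pdivrMr// div1r archi_boundP// invr_ge0 ltW.
  (* From index [N] on, |g_k e_0| is at least N+1, hence so is its square. *)
  have : - (N.+1%:R)^-1 <= mink w w.
    apply: (wC [set x : V | - (N.+1%:R)^-1 <= mink x x] N).
      apply: (@preimage_closed _ _ _ [set r : R | - (N.+1%:R)^-1 <= r]);
        last exact: closed_ge.
      by move=> x _; apply: (@cvg_mink R V (nbhs x) _ d id id); exact: cvg_id.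
    move=> k Nk /=; rewrite um lerN2 lef_pV2 ?posrE ?exprn_gt0 ?eucl_norm_gt0//;
      last by case: (he k).
    have kg : N.+1%:R <= eucl_norm (g k *m e).
      apply: le_trans (coord_le_eucl_norm _ 0); rewrite mulmx_time_vector.
      apply: le_trans (ler_norm _); apply: le_trans (ltW (gP k).2).
      by rewrite ler_nat.
    by have : 1 <= N.+1%:R :> R by [rewrite ler1n]; nra.
  rewrite lerNl -/q -div1r ler_pdivlMr ?ltr0n// -natr1; lra.
have wwE : mink w w = 0 by apply: le_anti; rewrite ww0 ww1.
exists w; split; last first.
  exists e; first exact: hyperbolic_time_vector.
  apply: closureS (cw 0%N) => _ [k _ <-]; exists (g k) => //.
  by have [] := gP k.
(* A null vector with zero time coordinate vanishes, against norm 1. *)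
split=> //; rewrite lt_def w0 andbT; apply/eqP => w00.
move: nw => /(congr1 (fun r => r ^+ 2)); rewrite eucl_norm_sqr big_ord_recl.
by rewrite space_sqr wwE w00 => /eqP; rewrite expr0n/= expr1n !addr0 eq_sym oner_eq0.
Qed.

(** The infinite orbit of one limit point supplies a second one, and a positive multiple of the sum
    of the two lies on the hyperboloid. *)
Lemma hyp_convex_hull_nonempty : exists x, hyp_convex_hull (limit_set G) x.
Proof.
have [v Lv] := limit_set_nonempty; have [Sv _] := Lv.
have [w [Lw vw]] : exists w, limit_set G w /\ v != w.
  apply: contrapT => nw; apply: (nonelementaryG (or_intror Sv)).
  apply: (@sub_finite_set _ _ [set v]); last exact: finite_set1.
  move=> _ [g Gg <-] /=; apply/esym/eqP; apply: contrapT => /negP vg.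
  by apply: nw; exists (normalize (g *m v)); split=> //; exact: limit_set_mulmx.
have [Sw _] := Lw; have vw0 := mink_Splus_lt0 Sv Sw vw.
have [vv v0 _] := Sv; have [ww w0 _] := Sw.
(* Normalizes [v + w], whose Lorentz square is [2 * mink v w], to square -1. *)
pose c := (Num.sqrt (- (2 * mink v w)))^-1.
have c0 : 0 < c by rewrite invr_gt0 sqrtr_gt0; lra.
exists (c *: (c^-1 *: 0 + 1 *: v) + c *: w); split; last first.
  apply: cone_hull_add; rewrite ?(ltW c0)//.
  apply: cone_hull_add; rewrite ?invr_ge0 ?(ltW c0)//.
  exact: cone_hull0.
rewrite scaler0 add0r scale1r; split; last first.
  by rewrite !mxE addr_gt0// mulr_gt0.
have c2 : c ^+ 2 * (- (2 * mink v w)) = 1.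
  rewrite exprVn sqr_sqrtr ?mulVf//; last by lra.
  by apply/eqP; lra.
rewrite !(minkDl, minkDr, minkZl, minkZr) vv ww (minkC w v); lra.
Qed.

End LimitSet.

(** * Bounded orbit representatives from compactness of the quotient *)

Section CocompactBound.
Variables (R : realType) (d : nat).
Local Notation V := 'cV[R]_d.+1.
Local Notation M := 'M[R]_d.+1.
Variables (G : set M) (A : set V).

(** The strict inequality makes this an open condition on [x]. *)
Definition orbit_meets_below (k : R) (x : V) : Prop :=
  exists2 g, G g & (g *m x) 0 0 < k.

Lemma orbit_meets_below_eq k x y : linear_orbit G x = linear_orbit G y ->
  orbit_meets_below k x -> orbit_meets_below k y.
Proof.
move=> xy [g Gg gk]; have : linear_orbit G x (g *m x) by exists g.
by rewrite xy => -[h Gh hE]; exists h => //; rewrite hE.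
Qed.

(** Points [x k] whose orbits stay at height at least [k] would have a cluster point in the
    quotient. It lies in some open [W m], which must then contain the class of some [x k] with
    [k >= m]: a contradiction. *)
Lemma compact_orbit_space_bound : G 1%:M -> compact [set: orbit_space G A] ->
  exists r, forall x, A x -> exists2 g, G g & (g *m x) 0 0 <= r.
Proof.
move=> G1 cA; apply: contrapT => nA.
have /choice[x xP] : forall k : nat, exists x : subspace_of A,
    ~ orbit_meets_below k%:R (set_val x).
  move=> k; apply: contrapT => nx; apply: nA; exists k%:R => x Ax.
  have : orbit_meets_below k%:R x.
    apply: contrapT => nk; apply: nx.
    by exists (SigSub (mem_set Ax) : subspace_of A).
  by case=> g Gg /ltW gk; exists g.
pose piA : subspace_of A -> orbit_space G A := \pi%qT.
have [|q [_ cq]] := cA ((fun k => piA (x k)) @ \oo) _.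
  by exists 0%N.
(* The condition is read on a chosen representative; [piW] shows that it holds equally on any
   other. *)
pose W (k : nat) : set (orbit_space G A) :=
  [set q | orbit_meets_below k%:R (set_val (repr q : subspace_of A))].
have piW k y : W k (piA y) <-> orbit_meets_below k%:R (set_val y).
  have e : linear_orbit G (set_val (repr (piA y) : subspace_of A)) =
      linear_orbit G (set_val y).
    have : orbit_rel G (repr (piA y)) y by apply/eqmodP; rewrite reprK.
    by move/asboolP.
  by split; apply: orbit_meets_below_eq; rewrite e.
have oW k : open (W k).
  have -> : open (W k) = open (piA @^-1` W k) by [].
  have -> : piA @^-1` W k = \bigcup_(g in G)
      [set y : subspace_of A | (g *m set_val y) 0 0 < k%:R].
    apply/seteqP; split=> y /=; first by move/piW => [g Gg gk]; exists g.
    by move=> [g Gg gk]; apply/piW; exists g.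
  apply: bigcup_open => g Gg.
  apply: (@open_comp _ _ (fun y : subspace_of A => (g *m set_val y) 0 0) [set t | t < k%:R]);
    last exact: open_lt.
  move=> y _.
  apply: (@cvg_coord R _ (nbhs y) _ _ _ (fun z : subspace_of A => g *m set_val z)).
  apply: (@cvg_mulmx R _ (nbhs y) _ _ _ _ g (fun z : subspace_of A => set_val z)).
  exact: initial_continuous.
pose t := (set_val (repr q : subspace_of A) : V) 0 0.
pose m := Num.bound t.
have Wq : W m q.
  exists 1%:M => //; rewrite mul1mx.
  have [t0|t0] := leP 0 t; first exact: archi_boundP.
  by apply: lt_le_trans t0 _.
have [|_ [[k mk <-] Wk]] := cq ((fun k => piA (x k)) @` [set k | (m <= k)%N]) _ _ (open_nbhs_nbhs (conj (oW m) Wq)).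
  by exists m => // k mk; exists k.
have /piW [g Gg gm] := Wk; apply: (xP k); exists g => //.
by apply: lt_le_trans gm _; rewrite ler_nat.
Qed.

End CocompactBound.

(** * Geodesic rays ending at an ideal point, parametrized by horospherical level *)

Section Rays.
Variables (R : realType) (d : nat).
Local Notation V := 'cV[R]_d.+1.
Implicit Types (v x y : V) (b c : R).

(* The point of the geodesic ray from x to the ideal point v that lies on the
   horosphere of level b at v. *)
Definition ray_point v x b : V :=
  (b / - mink v x) *: x + ((2 * b)^-1 - b / (2 * mink v x ^+ 2)) *: v.

Lemma Splus_level_gt0 v x : Splus v -> hyperbolic x -> 0 < - mink v x.
Proof.
by move=> Sv hx; rewrite oppr_gt0 mink_causal_lt0//;
  [exact: Splus_causal|case: Sv].
Qed.

Lemma mink_ray_point v x b : Splus v -> hyperbolic x ->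
  mink v (ray_point v x b) = - b.
Proof.
move=> Sv hx; have /lt0r_neq0 := Splus_level_gt0 Sv hx; rewrite oppr_eq0 => a0.
have [vv _ _] := Sv; rewrite /ray_point minkDr !minkZr vv mulr0 addr0.
by field.
Qed.

(** At equal levels [b = c] the right side tends to 1 as [b] tends to 0: rays with the same ideal
    endpoint are asymptotic. *)
Lemma mink_ray_points v x y b c : Splus v -> hyperbolic x -> hyperbolic y ->
  0 < b -> 0 < c ->
  - mink (ray_point v x b) (ray_point v y c) =
  b * c * (- mink x y) / (mink v x * mink v y) + b / (2 * c) + c / (2 * b)
  - b * c / (2 * mink v x ^+ 2) - b * c / (2 * mink v y ^+ 2).
Proof.
move=> Sv hx hy b0 c0; have [vv _ _] := Sv.
have /lt0r_neq0 := Splus_level_gt0 Sv hx; rewrite oppr_eq0 => x0.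
have /lt0r_neq0 := Splus_level_gt0 Sv hy; rewrite oppr_eq0 => y0.
rewrite /ray_point !(minkDl, minkDr, minkZl, minkZr) vv (minkC x v).
by field; rewrite x0 y0 !gt_eqF.
Qed.

Lemma mink_same_ray v x b c : Splus v -> hyperbolic x -> 0 < b -> 0 < c ->
  - mink (ray_point v x b) (ray_point v x c) = b / (2 * c) + c / (2 * b).
Proof.
move=> Sv hx b0 c0; rewrite mink_ray_points// hx.1.
have /lt0r_neq0 := Splus_level_gt0 Sv hx; rewrite oppr_eq0 => x0.
by field; rewrite x0 !gt_eqF.
Qed.

Lemma ray_point_level v x : Splus v -> hyperbolic x ->
  ray_point v x (- mink v x) = x.
Proof.
move=> Sv hx; have /lt0r_neq0 a0 := Splus_level_gt0 Sv hx.
rewrite /ray_point divff// scale1r.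
have -> : (2 * - mink v x)^-1 - (- mink v x) / (2 * mink v x ^+ 2) = 0.
  by rewrite oppr_eq0 in a0; field.
by rewrite scale0r addr0.
Qed.

(** A level at most that of [x] means moving towards [v], so [v] enters with a nonnegative
    coefficient and the ray stays in the hull. *)
Lemma ray_coef_ge0 v x b : Splus v -> hyperbolic x -> 0 < b <= - mink v x ->
  0 <= (2 * b)^-1 - b / (2 * mink v x ^+ 2).
Proof.
move=> Sv hx /andP[b0 ba]; have a0 := Splus_level_gt0 Sv hx.
have -> : (2 * b)^-1 - b / (2 * mink v x ^+ 2) =
    (mink v x ^+ 2 - b ^+ 2) / (2 * b * mink v x ^+ 2).
  by field; rewrite -oppr_eq0 !gt_eqF.
apply: divr_ge0; first by nra.
by apply: mulr_ge0; [rewrite mulr_ge0 ?ltW|exact: sqr_ge0].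
Qed.

Lemma hyperbolic_ray_point v x b : Splus v -> hyperbolic x ->
  0 < b <= - mink v x -> hyperbolic (ray_point v x b).
Proof.
move=> Sv hx bx; have /andP[b0 _] := bx; split.
  apply: oppr_inj; rewrite mink_same_ray// opprK; by field; rewrite gt_eqF.
have := ray_coef_ge0 Sv hx bx; have [_ v0 _] := Sv; have [_ x0] := hx.
rewrite !mxE => c0; apply: ltr_wpDr; first by rewrite mulr_ge0// ltW.
by rewrite mulr_gt0// divr_gt0//; exact: Splus_level_gt0.
Qed.

Lemma hull_ray_point (L : set V) v x b : L v -> Splus v ->
  hyp_convex_hull L x -> 0 < b <= - mink v x ->
  hyp_convex_hull L (ray_point v x b).
Proof.
move=> Lv Sv [hx cx] bx; split; first exact: hyperbolic_ray_point.
apply: cone_hull_add => //; first exact: (ray_coef_ge0 Sv hx bx).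
by have /andP[b0 _] := bx; rewrite divr_ge0 ?ltW//; exact: Splus_level_gt0.
Qed.

End Rays.

(** * Growth of a cocycle along tracked rays *)

Section CocycleGrowth.
Variables (R : realType) (d : nat).
Local Notation V := 'cV[R]_d.+1.
Local Notation M := 'M[R]_d.+1.
Implicit Types (g h : M) (v x y : V).
Variables (G : set M) (tau : M -> V) (r : R).
Hypothesis discreteG : discrete_subgroup G.
Hypothesis cocycle_tau : cocycle G tau.

Lemma cocycle1 : tau 1%:M = 0.
Proof.
have G1 := group_one discreteG.
have := cocycle_tau G1 G1; rewrite !mul1mx => /eqP.
by rewrite eq_sym -subr_eq0 addrK => /eqP.
Qed.

Lemma cocycle_inv g : G g -> tau (invmx g) = - (invmx g *m tau g).
Proof.
move=> Gg; have Gi := group_inv discreteG Gg.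
have := cocycle_tau Gi Gg.
rewrite mulVmx ?(discrete_unitmx discreteG)// cocycle1 => /esym/eqP.
by rewrite addr_eq0 => /eqP.
Qed.

(** The last condition bounds the distance from [x] to g e_0: the time coordinate of a point of the
    hyperboloid is the cosh of its distance to e_0. *)
Definition tracks g x : Prop := [/\ G g, hyperbolic x & (invmx g *m x) 0 0 <= r].

(** A multiplicative triangle inequality: [causal_time_le] gives first [Y <= 2 * X * q <= 4 * r],
    then the bound [2 * Y * Z]. *)
Lemma tracks_time_le g h x y : tracks g x -> tracks h y -> - mink x y <= 2 ->
  (invmx g *m h) 0 0 <= 8 * r ^+ 2.
Proof.
move=> [Gg hx gx] [Gh hy hyr] xy.
have fut k : G k -> future_lorentz k by exact: discrete_future.
have Gi := group_inv discreteG Gg; have Gj := group_inv discreteG Gh.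
have hgx := future_lorentz_hyperbolic (fut _ Gi) hx.
have hgy := future_lorentz_hyperbolic (fut _ Gi) hy.
have Gf := group_mul discreteG Gi Gh.
have hfe := future_lorentz_hyperbolic (fut _ Gf) (hyperbolic_time_vector R d).
have b1 := causal_time_le (hyperbolic_causal hgy) hgx.
rewrite (fut _ Gi).1 minkC in b1.
have b2 := causal_time_le (hyperbolic_causal hfe) hgy.
have fE : invmx g *m y = invmx g *m h *m (invmx h *m y).
  by rewrite mulmxA -(mulmxA _ h) mulmxV ?mulmx1// (discrete_unitmx discreteG).
rewrite [in X in - X]fE (fut _ Gf).1 minkC mink_time opprK mulmx_time_vector in b2.
have := hyperbolic_time_ge1 hgx; have := hyperbolic_time_ge1 hgy.
have hjy := future_lorentz_hyperbolic (fut _ Gj) hy.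
have := hyperbolic_time_ge1 hjy.
move: b1 b2 gx hyr xy.
set X := (invmx g *m x) 0 0; set Y := (invmx g *m y) 0 0.
set Z := (invmx h *m y) 0 0; set q := - mink x y => b1 b2 Xr Zr q2 Z1 Y1 X1.
have Y4 : Y <= 4 * r by nra.
by apply: (le_trans b2); nra.
Qed.

(** With f = g^-1 h in a finite set, the increment is <g^-1 v | tau f>. The time coordinate of g^-1
    v is compared with the level of [x] by pairing with g^-1 x, whose height is at most [r]. *)
Lemma cocycle_step : exists2 C, 0 <= C & forall v g h x y, Splus v ->
  tracks g x -> tracks h y -> - mink x y <= 2 ->
  `|mink v (tau h) - mink v (tau g)| <= C * - mink v x.
Proof.
have [B B0 BP] : exists2 B, 0 <= B & forall f, G f -> f 0 0 <= 8 * r ^+ 2 ->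
    l1_norm (tau f) <= B.
  have /finite_seqP[s sE] := finite_time_le discreteG (8 * r ^+ 2).
  have l0 f : 0 <= l1_norm (tau f) by apply: sumr_ge0 => i _; exact: normr_ge0.
  exists (\sum_(f <- s) l1_norm (tau f)); first by apply: sumr_ge0 => f _.
  move=> f Gf fr; have : [set` s] f by rewrite -sE.
  move=> /= fs; rewrite (big_rem f)//= lerDl; exact: sumr_ge0.
exists (2 * `|r| * B); first by rewrite !mulr_ge0.
move=> v g h x y Sv gx hy xy.
have fr := tracks_time_le gx hy xy.
have [Gg hx gr] := gx; have [Gh _ _] := hy.
have Gi := group_inv discreteG Gg; have Gf := group_mul discreteG Gi Gh.
have fi := discrete_future discreteG Gi.
have -> : mink v (tau h) - mink v (tau g) =
    mink (invmx g *m v) (tau (invmx g *m h)).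
  have -> : tau h = tau g + g *m tau (invmx g *m h).
    rewrite -cocycle_tau// mulmxA mulmxV ?mul1mx//.
    exact: (discrete_unitmx discreteG).
  by rewrite minkDr addrAC subrr add0r -(mink_invmx discreteG).
have cv : future_causal (invmx g *m v).
  apply: future_lorentz_causal => //; first exact: Splus_causal.
  by case: Sv.
have hgx := future_lorentz_hyperbolic fi hx.
have := causal_time_le cv hgx; rewrite fi.1 => vb.
have a0 := Splus_level_gt0 Sv hx; have t1 := hyperbolic_time_ge1 hgx.
apply: (le_trans (norm_mink_le _ cv)).
rewrite mulrAC; apply: ler_pM => //; first by case: cv.
- by apply: sumr_ge0 => i _; exact: normr_ge0.
- apply: (le_trans vb); rewrite ler_pM2r// ler_pM2l//.
  exact: (le_trans gr (ler_norm _)).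
- exact: BP.
Qed.

Variable L : set V.
Hypothesis Splus_L : L `<=` @Splus R d.
Hypothesis hull_tracks : forall x, hyp_convex_hull L x -> exists g, tracks g x.
Hypothesis hull_mulmx : forall g x, G g -> hyp_convex_hull L x ->
  hyp_convex_hull L (g *m x).

(* Along the ray to [v] the level decreases geometrically, so the increments
   of [tau] paired with [v] sum up to a multiple of the initial level. *)
Lemma cocycle_ray C v g x : 0 <= C ->
  (forall g h x y, tracks g x -> tracks h y -> - mink x y <= 2 ->
    `|mink v (tau h) - mink v (tau g)| <= C * - mink v x) ->
  L v -> hyp_convex_hull L x -> tracks g x ->
  forall b, 0 < b <= - mink v x ->
  exists2 h, tracks h (ray_point v x b) &
    `|mink v (tau h) - mink v (tau g)| <= 3 * C * - mink v x.
Proof.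
move=> C0 stepC Lv hux gx b0 bx.
have [hx _] := hux; have Sv := Splus_L Lv; have a0 := Splus_level_gt0 Sv hx.
set a := - mink v x in a0 bx *.
(* Down to half the initial level a single step suffices. *)
have one b : 0 < b <= a -> a <= 2 * b -> exists2 h, tracks h (ray_point v x b) &
    `|mink v (tau h) - mink v (tau g)| <= C * a.
  move=> ba ab; have [h hb] := hull_tracks (hull_ray_point Lv Sv hux ba).
  exists h => //; apply: stepC gx hb _; have /andP[b1 b2] := ba.
  rewrite -{1}(ray_point_level Sv hx) mink_same_ray// -/a.
  have : a / (2 * b) <= 1 by rewrite ler_pdivrMr ?mul1r// mulr_gt0.
  have : b / (2 * a) <= 1 by rewrite ler_pdivrMr ?mul1r ?mulr_gt0//; lra.
  lra.
(* Induction on the number of halvings: going from level 2b to b costs C * 2b = 2C (2b - b), which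
   telescopes to 2C (a - b). *)
have chain n : forall b, 0 < b <= a -> a <= 2 ^+ n * b ->
    exists2 h, tracks h (ray_point v x b) &
    `|mink v (tau h) - mink v (tau g)| <= C * a + 2 * C * (a - b).
  elim: n => [|n IH] b ba ab; have /andP[b1 b2] := ba.
    have [|h hb hC] := one b ba; first by rewrite mul1r in ab; lra.
    by exists h => //; apply: (le_trans hC); nra.
  have [ab2|ab2] := leP a (2 * b).
    have [h hb hC] := one b ba ab2.
    by exists h => //; apply: (le_trans hC); nra.
  have b2a : 0 < 2 * b <= a by lra.
  have [|h hb hC] := IH (2 * b) b2a; first by rewrite mulrA -exprSr.
  have [k kb] := hull_tracks (hull_ray_point Lv Sv hux ba).
  exists k => //; have /(stepC _ _ _ _ hb kb) : 
      - mink (ray_point v x (2 * b)) (ray_point v x b) <= 2.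
    have -> : - mink (ray_point v x (2 * b)) (ray_point v x b) = 5 / 4.
      by rewrite mink_same_ray//; [field; rewrite gt_eqF|lra].
    by lra.
  rewrite mink_ray_point// opprK => kC.
  have -> : mink v (tau k) - mink v (tau g) =
    (mink v (tau k) - mink v (tau h)) + (mink v (tau h) - mink v (tau g)) by ring.
  by apply: (le_trans (ler_normD _ _)); lra.
have /andP[b1 b2] := bx.
have [|h hb hC] := chain (Num.bound (a / b0)) b0 bx.
  rewrite -ler_pdivrMr//; apply: (le_trans (ltW (archi_boundP _))).
    by rewrite divr_ge0// ltW.
  by rewrite -natrX ler_nat ltnW// ltn_expl.
by exists h => //; apply: (le_trans hC); nra.
Qed.

(** The rays from [g *m p] and [p] cost 3C a' and 3C a, and passing between them at level [b] costs
    C b <= C a. The choice T = 3C cancels the term in a', the only one depending on [g]. *)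
Lemma cocycle_bounded_above v p : L v -> hyp_convex_hull L p ->
  exists x S, forall g, G g -> mink v (tau g + g *m x) <= S.
Proof.
move=> Lv hup; have Sv := Splus_L Lv.
have [g0 pg0] := hull_tracks hup; have [Gg0 _ gr0] := pg0.
have Gi := group_inv discreteG Gg0.
(* Moving [p] by the inverse of [g0] lets the identity, where [tau] vanishes, track it. *)
wlog pr : p hup g0 pg0 Gg0 gr0 Gi / p 0 0 <= r.
  move=> wl; apply: (wl (invmx g0 *m p) _ 1%:M) => //.
  - exact: hull_mulmx.
  - have G1 := group_one discreteG; split=> //; last by rewrite invmx1 mul1mx.
    by have [] := hull_mulmx Gi hup.
  - exact: group_one.
  - by rewrite invmx1 mul1mx.
  - by rewrite invmx1; exact: group_one.
have [C C0 stepC] := cocycle_step.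
have {}stepC g h x y := @stepC v g h x y Sv.
have [hp _] := hup; have a0 := Splus_level_gt0 Sv hp.
exists ((3 * C) *: p), (4 * C * - mink v p) => g Gg.
have hugp := hull_mulmx Gg hup; have [hgp _] := hugp.
have ag := Splus_level_gt0 Sv hgp.
have G1 := group_one discreteG.
have trg : tracks g (g *m p).
  by split=> //; rewrite mulmxA mulVmx ?mul1mx// (discrete_unitmx discreteG).
have tr1 : tracks 1%:M p by split=> //; rewrite invmx1 mul1mx.
have q0 : 0 < - mink p (g *m p).
  by rewrite oppr_gt0 mink_causal_lt0//; [exact: hyperbolic_causal|case: hp].
pose a := - mink v p; pose a' := - mink v (g *m p); pose q := - mink p (g *m p).
have [b [b0 ba ba' bq]] : exists b, [/\ 0 < b, b <= a, b <= a' & b ^+ 2 * q <= a * a'].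
  (* The bound by 1 gives b^2 q <= b q, and the last bound gives b q <= a a'. *)
  pose b := Num.min (Num.min a a') (Num.min 1 (a * a' / q)).
  have b0 : 0 < b by rewrite !lt_min a0 ag ltr01/= divr_gt0// mulr_gt0.
  have : b <= b by []; rewrite {2}/b !le_min => /andP[/andP[ba ba'] /andP[b1 bq]].
  exists b; split=> //; rewrite ler_pdivlMr// in bq.
  by apply: le_trans bq; rewrite ler_pM2r// expr2 ler_piMl// ltW.
have [|h hb hC] := cocycle_ray C0 stepC Lv hugp trg (b := b); first by rewrite b0.
have [|k kb kC] := cocycle_ray C0 stepC Lv hup tr1 (b := b); first by rewrite b0.
have /(stepC _ _ _ _ kb hb) : 
    - mink (ray_point v p b) (ray_point v (g *m p) b) <= 2.
  rewrite mink_ray_points//.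
  have -> : b / (2 * b) = 2^-1 by field; rewrite gt_eqF.
  have t1 : b * b * - mink p (g *m p) / (mink v p * mink v (g *m p)) <= 1.
    rewrite -[mink v p * _]mulrNN ler_pdivrMr ?mulr_gt0// mul1r -expr2.
    exact: bq.
  have t2 x : 0 <= b * b / (2 * mink v x ^+ 2).
    by apply: divr_ge0; apply: mulr_ge0; rewrite ?sqr_ge0 ?(ltW b0).
  by have := t2 p; have := t2 (g *m p); lra.
rewrite mink_ray_point// opprK => hkC.
move: hC kC hkC; rewrite cocycle1.
have -> : mink v 0 = 0 by rewrite -(scale0r 0) minkZr mul0r.
rewrite subr0 !ler_norml => /andP[h1 h2] /andP[k1 k2] /andP[s1 s2].
rewrite minkDr -scalemxAr minkZr -/a; rewrite -/a -/a' in h1 h2 k1 k2 *.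
have -> : mink v (g *m p) = - a' by rewrite opprK.
have : C * b <= C * a by rewrite ler_wpM2l.
lra.
Qed.

End CocycleGrowth.

(** * The invariant domain cut out by the hyperplanes bounding an orbit *)

Section InvariantDomain.
Variables (R : realType) (d : nat).
Local Notation V := 'cV[R]_d.+1.
Local Notation M := 'M[R]_d.+1.
Variables (G : set M) (tau : M -> V) (x : V).
Hypothesis discreteG : discrete_subgroup G.
Hypothesis cocycle_tau : cocycle G tau.

Definition orbit_hyperplanes : set (V * R) :=
  [set h | Splus h.1 /\ forall g, G g -> mink h.1 (affine_action tau g x) <= h.2].

(** Null vectors of norm 1 have nonzero time coordinate, so the strict sign condition can be
    replaced by a closed one. *)
Lemma Splus_closedE : @Splus R d =
  [set v | mink v v = 0] `&` [set v | 0 <= v 0 0] `&` [set v | eucl_norm v = 1].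
Proof.
apply/seteqP; split=> v; first by move=> [vv v0 nv]; split=> //; split=> //; exact: ltW.
move=> [[/= vv v0] nv]; split=> //; rewrite lt_def v0 andbT; apply/eqP => v00.
move: nv => /(congr1 (fun r => r ^+ 2)); rewrite eucl_norm_sqr big_ord_recl.
by rewrite space_sqr vv v00 => /eqP; rewrite expr0n/= expr1n !addr0 eq_sym oner_eq0.
Qed.

Lemma closed_Splus : closed (@Splus R d).
Proof.
rewrite Splus_closedE; apply: closedI; first apply: closedI.
- apply: (@preimage_closed _ _ (fun v : V => mink v v) [set r : R | r = 0]);
    last exact: closed_eq.
  by move=> v _; apply: (@cvg_mink R V (nbhs v) _ d id id); exact: cvg_id.
- apply: (@preimage_closed _ _ (fun v : V => v 0 0) [set r : R | 0 <= r]);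
    last exact: closed_ge.
  by move=> v _; exact: coord_continuous.
- apply: (@preimage_closed _ _ _ [set r : R | r = 1]); last exact: closed_eq.
  by move=> v _; apply: (@cvg_eucl_norm R V (nbhs v) _ d id); exact: cvg_id.
Qed.

Lemma closed_orbit_hyperplanes : closed orbit_hyperplanes.
Proof.
have -> : orbit_hyperplanes = (fst @^-1` @Splus R d) `&`
    \bigcap_(g in G) [set h : V * R | mink h.1 (affine_action tau g x) - h.2 <= 0].
  apply/seteqP; split=> h [Sh hG]; split=> // g Gg.
    by rewrite /= subr_le0; exact: hG.
  by have := hG g Gg; rewrite /= subr_le0.
apply: closedI.
  apply: preimage_closed; last exact: closed_Splus.
  by move=> h _; exact: cvg_fst.
apply: closed_bigI => g _.
apply: (@preimage_closed _ _
    (fun h : V * R => mink h.1 (affine_action tau g x) - h.2) [set r : R | r <= 0]);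
  last exact: closed_le.
move=> h _; apply: cvgB; last exact: cvg_snd.
by apply: (@cvg_mink R _ (nbhs h) _ d fst (fun=> _));
  [exact: cvg_fst|exact: cvg_cst].
Qed.

Lemma orbit_hyperplanes_domain v S : Splus v ->
  (forall g, G g -> mink v (affine_action tau g x) <= S) ->
  future_complete_regular_domain (Omega_plus orbit_hyperplanes).
Proof.
move=> Sv vS; split.
  exists (x + time_vector R d) => h [Sh hG].
  have := hG _ (group_one discreteG).
  rewrite /affine_action mul1mx (cocycle1 discreteG cocycle_tau) addr0 minkDr.
  by rewrite mink_time; have [_ h0 _] := Sh; lra.
exists orbit_hyperplanes; split=> //.
- by move=> h [].
- exact: closed_orbit_hyperplanes.
- exists (v, S), (v, S + 1); split.
  + by split.
  + by split=> // g Gg /=; apply: (le_trans (vS g Gg)); lra.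
  + by apply/eqP => -[]; lra.
Qed.

(** The pullback of a hyperplane of the family by the action of [g] is again in the family, since
    left translation by [g] maps the group into itself; normal and level are rescaled together to
    restore norm 1. *)
Lemma affine_action_Omega_sub g : G g ->
  affine_action tau g @` Omega_plus orbit_hyperplanes `<=` Omega_plus orbit_hyperplanes.
Proof.
move=> Gg _ [p Op <-] [v s] [/= Sv vG].
have Gi := group_inv discreteG Gg; have [vv v0 _] := Sv.
have fi := discrete_future discreteG Gi.
pose w := invmx g *m v.
have w0 : 0 < w 0 0 by apply: future_lorentz_time_gt0; rewrite ?vv.
have n0 := eucl_norm_gt0 w0.
have wp y : mink w y = mink v (g *m y) by rewrite (mink_invmx discreteG).
have wE : normalize w = (eucl_norm w)^-1 *: w by [].
have /Op : orbit_hyperplanes (normalize w, (eucl_norm w)^-1 * (s - mink v (tau g))).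
  split=> [|h Gh] /=; first exact: (Splus_mulmx discreteG).
  rewrite wE minkZl ler_pM2l ?invr_gt0// wp lerBrDr -minkDr.
  have := vG _ (group_mul discreteG Gg Gh).
  by rewrite /affine_action cocycle_tau// mulmxDr mulmxA addrA addrAC.
rewrite /= wE minkZl ltr_pM2l ?invr_gt0// wp ltrBrDr -minkDr.
exact.
Qed.

Lemma preserves_orbit_hyperplanes : preserves G tau (Omega_plus orbit_hyperplanes).
Proof.
move=> g Gg; apply/seteqP; split; first exact: affine_action_Omega_sub.
move=> p Op; have Gi := group_inv discreteG Gg.
exists (affine_action tau (invmx g) p).
  by apply: (affine_action_Omega_sub Gi); exists p.
have ug := discrete_unitmx discreteG Gg.
rewrite /affine_action (cocycle_inv discreteG cocycle_tau Gg) mulmxBr !mulmxA mulmxV//.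
by rewrite !mul1mx subrK.
Qed.

End InvariantDomain.

(** Brings the cocompactness hypothesis, stated on neighborhoods, to the hull itself. *)
Lemma hull_sub_core_neighborhood (R : realType) (d : nat) (L : set 'cV[R]_d.+1)
    (eps : R) :
  0 <= eps -> hyp_convex_hull L `<=` hyp_neighborhood eps (hyp_convex_hull L).
Proof.
move=> e0 x hx; have [hypx _] := hx; split=> //.
apply: (@le_trans _ _ (hyp_dist x x)%:E); first by apply: ereal_inf_lbound; exists x.
by rewrite /hyp_dist hypx.1 opprK /arcosh expr1n subrr sqrtr0 addr0 ln1 lee_fin.
Qed.

Theorem theorem4p25 (R : realType) (d : nat) (Gamma : set 'M[R]_d.+1)
  (Gamma_kleinian : kleinian Gamma)
  (Gamma_convex_cocompact : convex_cocompact Gamma) :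
  Tplus Gamma = H1 Gamma.
Proof.
have [disc nonel _] := Gamma_kleinian; have [_ coc] := Gamma_convex_cocompact.
apply/seteqP; split=> _ [tau ctau <-]; first by exists tau => //; case: ctau.
exists tau => //; split=> //.
have hull_mulmx g x : Gamma g -> hyp_convex_hull (limit_set Gamma) x ->
    hyp_convex_hull (limit_set Gamma) (g *m x).
  move=> Gg [hx cx]; split; last exact: (cone_hull_mulmx disc Gg cx).
  exact: (future_lorentz_hyperbolic (discrete_future disc Gg) hx).
have [r rP] := compact_orbit_space_bound (group_one disc) (coc 1 ltr01).
have hull_tracks x : hyp_convex_hull (limit_set Gamma) x ->
    exists g, tracks Gamma r g x.
  move=> hux; have [g Gg gr] := rP _ (hull_sub_core_neighborhood ler01 hux).
  (* [tracks] applies the inverse of its element, so the inverse of the element lowering [x] is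
     taken. *)
  exists (invmx g); split; [exact: (group_inv disc)|by case: hux|by rewrite invmxK].
have [v Lv] := limit_set_nonempty disc nonel.
have [p hup] := hyp_convex_hull_nonempty disc nonel.
have Splus_L : limit_set Gamma `<=` @Splus R d by move=> w [].
have [x [S xS]] := cocycle_bounded_above disc ctau Splus_L hull_tracks hull_mulmx Lv hup.
exists (Omega_plus (orbit_hyperplanes Gamma tau x)).
  apply: (orbit_hyperplanes_domain disc ctau (Splus_L _ Lv) (S := S)) => g Gg.
  by rewrite /affine_action addrC; exact: xS.
exact: (preserves_orbit_hyperplanes x disc ctau).
Qed.
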